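(* Let $n\ge 2$ be an integer and let $\mathcal{G}$ be any $n$-grid. Then there exist $\delta\in\mathbb{R}$ and a sequence $\mathbf{a}=(a_0,a_1,\dots,a_j,\dots)$ with $a_i\in\{0,1,\dots,n-1\}$ for all $i$, such that $\mathcal{G}=\mathcal{G}(\delta,\mathcal{L}_{\mathbf{a}})$.
   Context: Fix an integer $n\ge 2$; $\mathbb{N}=\{0,1,2,\dots\}$. General dyadic grid with base $n$ ($n$-grid): a collection $\mathcal{G}$ of left-closed, right-open intervals on $\mathbb{R}$ such that (i) every $Q\in\mathcal{G}$ has length $n^k$ for some $k\in\mathbb{Z}$; (ii) $Q\cap R\in\{Q,R,\emptyset\}$ for all $Q,R\in\mathcal{G}$; (iii) for each fixed $k\in\mathbb{Z}$ the intervals of $\mathcal{G}$ of length $n^k$ form a partition of $\mathbb{R}$. Location function: for a sequence $\mathbf{a}=(a_0,a_1,\dots)$ with $a_i\in\{0,1,\dots,n-1\}$, $\mathcal{L}_{\mathbf{a}}:\mathbb{N}\to\mathbb{N}$ is given by $\mathcal{L}_{\mathbf{a}}(0)=0$ and $\mathcal{L}_{\mathbf{a}}(j)=\sum_{i=0}^{j-1}a_i n^i$ for $j\ge 1$. The collection $\mathcal{G}(\delta,\mathcal{L}_{\mathbf{a}})$, for $\delta\in\mathbb{R}$, is the union over $m\in\mathbb{Z}$ of its $m$-th generations $\mathcal{G}(\delta,\mathcal{L}_{\mathbf{a}})_m$, where for $m\ge 0$ $$\mathcal{G}(\delta,\mathcal{L}_{\mathbf{a}})_m=\left\{\left[\delta+\tfrac{k}{n^m},\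 \delta+\tfrac{k+1}{n^m}\right):k\in\mathbb{Z}\right\},$$ and for $m<0$ $$\mathcal{G}(\delta,\mathcal{L}_{\mathbf{a}})_m=\left\{\left[\delta+\mathcal{L}_{\mathbf{a}}(-m)+\tfrac{k}{n^m},\ \delta+\mathcal{L}_{\mathbf{a}}(-m)+\tfrac{k+1}{n^m}\right):k\in\mathbb{Z}\right\}.$$ *)

(* Defs.v *)
From mathcomp Require Import all_boot all_order all_algebra.
From mathcomp Require Import classical_sets set_interval reals.

Set Implicit Arguments.
Unset Strict Implicit.
Unset Printing Implicit Defensive.

Import Order.TTheory GRing.Theory Num.Theory.

Local Open Scope classical_set_scope.
Local Open Scope ring_scope.

(* Left-closed, right-open intervals; for [0 < l], [l] is determined by [Q]. *)
Definition lcro_interval (R : realType) (l : R) (Q : set R) : Prop :=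
  exists x y : R, Q = `[x, y[%classic /\ y - x = l.

Record n_grid (R : realType) (n : nat) (G : set (set R)) : Prop := NGrid {
  grid_length : forall Q, G Q -> exists k : int, lcro_interval (n%:R ^ k) Q ;
  grid_nested : forall Q S, G Q -> G S ->
    [\/ Q `&` S = Q, Q `&` S = S | Q `&` S = set0] ;
  grid_partition : forall k : int,
    partition [set Q | G Q /\ lcro_interval (n%:R ^ k) Q] id [set: R]
}.

Definition location (n : nat) (a : nat -> 'I_n) (j : nat) : nat :=
  (\sum_(i < j) a i * n ^ i)%N.

(* When [m < 0], the natural number [- m] is [`|m|]. *)
Definition grid_generation (R : realType) (n : nat) (delta : R)
    (L : nat -> nat) (m : int) : set (set R) :=
  if 0 <= m then
    [set `[delta + k%:~R / n%:R ^ m, delta + (k + 1)%:~R / n%:R ^ m[%classic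
      | k in [set: int]]
  else
    [set `[delta + (L `|m|%N)%:R + k%:~R / n%:R ^ m,
           delta + (L `|m|%N)%:R + (k + 1)%:~R / n%:R ^ m[%classic
      | k in [set: int]].

Definition grid (R : realType) (n : nat) (delta : R) (L : nat -> nat) :
    set (set R) :=
  \bigcup_(m in [set: int]) grid_generation n delta L m.

(* Main.v *)
Require Import Defs.
From mathcomp Require Import all_boot all_order all_algebra.
From mathcomp Require Import classical_sets reals.
From mathcomp Require Import boolp lra.

(** For each integer [k] let [E_k] be the set of left endpoints of the
intervals of [G] of length [n ^ k]; the grid is determined by these sets.

Two facts describe them.  Since half-open intervals of a common length [l]
that partition the line must follow one another without gaps, [E_k] is a coset
of [n ^ k Z] ([tiling_coset]).  Since the interval of length [n ^ k] that
contains the left endpoint of an interval of length [n ^ (k + 1)] lies inside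
the latter, both start at the same point, so that [E_(k + 1)] is contained in
[E_k] ([left_endpoints_sub]).

Hence any [delta] in [E_0] lies in every [E_(- m)] with [m] natural, which
settles all the small scales.  For the large scales one goes up from [delta]:
if [delta + L] is in [E_j], then [E_(j + 1)] is a coset of [n ^ (j + 1) Z]
inside the coset [delta + L + n ^ j Z], so exactly one of the [n] points
[delta + L + a n ^ j] with [a < n] belongs to it; this [a] is the digit [a_j],
and the offsets obtained from the digits are the values of the location
function ([exists_location]). *)

Set Implicit Arguments.
Unset Strict Implicit.
Unset Printing Implicit Defensive.

Import Order.TTheory GRing.Theory Num.Theory.

Local Open Scope classical_set_scope.
Local Open Scope ring_scope.

(** A partition of the line into half-open intervals of length [l], recorded
by the set [E] of their left endpoints. *)
Definition tiling (R : realType) (l : R) (E : set R) : Prop :=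
  (forall t, exists2 x, E x & x <= t < x + l) /\
  (forall x y t, E x -> E y -> x <= t < x + l -> y <= t < y + l -> x = y).

(** The tile that contains [x + l] cannot start before [x + l], as it would
then meet, hence be, the tile that starts at [x]. *)
Lemma tiling_next (R : realType) (l : R) (E : set R) (x : R) :
  0 < l -> tiling l E -> E x -> E (x + l).
Proof.
move=> l0 [cov dis] Ex.
have [y Ey /andP[y1 y2]] := cov (x + l).
have [yx|xy] := ltP y (x + l); last first.
  by have -> : x + l = y by lra.
have [xy|/ltW yx'] := leP x y.
  have exy : x = y by apply: (dis x y y) => //; lra.
  by move: y2; rewrite exy ltxx.
have exy : x = y by apply: (dis x y x) => //; lra.
by move: y2; rewrite exy ltxx.
Qed.

(** The tile that contains [x - l] is followed by a tile that contains [x],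
which can only be the one that starts at [x]. *)
Lemma tiling_prev (R : realType) (l : R) (E : set R) (x : R) :
  0 < l -> tiling l E -> E x -> E (x - l).
Proof.
move=> l0 tE Ex.
have [y Ey /andP[y1 y2]] := tE.1 (x - l).
have exy : x = y + l.
  by apply: (tE.2 _ _ x Ex (tiling_next l0 tE Ey)); lra.
by rewrite exy addrK.
Qed.

Lemma tiling_coset (R : realType) (l : R) (E : set R) (x : R) :
  0 < l -> tiling l E -> E x -> forall y, E y <-> exists z : int, y = x + z%:~R * l.
Proof.
move=> l0 tE Ex y.
have shift (z : int) : E (x + z%:~R * l).
  elim: z => [|m IH|m IH]; first by rewrite mul0r addr0.
    rewrite -addn1 PoszD intrD mulrDl mul1r addrA.
    exact: tiling_next.
  rewrite -addn1 PoszD opprD intrD mulrDl mulN1r addrA.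
  exact: tiling_prev.
split=> [Ey|[z ->]//].
(* The translate of [x] that starts the tile containing [y]. *)
exists (Num.floor ((y - x) / l)); set z := Num.floor _.
have /andP[z1 z2] : z%:~R <= (y - x) / l < (z + 1)%:~R := real_floor_itv (num_real _).
apply: (tE.2 _ _ y Ey (shift z)); first by lra.
move: z1 z2; rewrite ler_pdivlMr// ltr_pdivrMr// intrD mulrDl mul1r; lra.
Qed.

Definition left_endpoints (R : realType) (n : nat) (G : set (set R)) (k : int) :
    set R :=
  [set x | G `[x, x + n%:R ^ k[%classic].

Section Grid.
Variables (R : realType) (n : nat) (G : set (set R)).
Hypotheses (hn : (2 <= n)%N) (hG : n_grid n G).
Local Notation E := (left_endpoints n G).

Lemma scale_gt0 (k : int) : 0 < n%:R ^ k :> R.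
Proof. by apply: exprz_gt0; rewrite ltr0n (ltn_trans _ hn). Qed.

Lemma scaleS (k : int) : n%:R ^ (k + 1) = n%:R * n%:R ^ k :> R.
Proof. by rewrite exprzDr ?expr1z 1?mulrC// unitfE pnatr_eq0 -lt0n ltnW. Qed.

Lemma lcro_intervalE (l : R) (Q : set R) :
  lcro_interval l Q <-> exists x, Q = `[x, x + l[%classic.
Proof.
split=> [[x [y [-> <-]]]|[x ->]]; exists x; first by rewrite addrC subrK.
by exists (x + l); split=> //; rewrite [LHS]addrC addKr.
Qed.

Lemma left_endpoints_tiling (k : int) : tiling (n%:R ^ k) (E k).
Proof.
have [cov /trivIsetP dis _] := grid_partition hG k.
split=> [t|x y t Ex Ey tx ty].
  have : [set: R] t by [].
  rewrite -cov => -[Q [GQ /lcro_intervalE[x eQ]]] /=.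
  rewrite eQ /= in_itv /= => ht; exists x => //.
  by rewrite /left_endpoints /= -eQ.
have l0 := scale_gt0 k.
have [eq_tiles|/eqP neq] :=
  pselect (`[x, x + n%:R ^ k[%classic = `[y, y + n%:R ^ k[%classic).
  have : `[y, y + n%:R ^ k[%classic x by rewrite -eq_tiles /= in_itv /=; lra.
  have : `[x, x + n%:R ^ k[%classic y by rewrite eq_tiles /= in_itv /=; lra.
  by rewrite /= !in_itv /=; lra.
have := dis _ _ (conj Ex _) (conj Ey _) neq.
move=> /(_ (proj2 (lcro_intervalE _ _) (ex_intro _ x erefl))).
move=> /(_ (proj2 (lcro_intervalE _ _) (ex_intro _ y erefl))).
rewrite -subset0 => /(_ t) []; split; rewrite /= in_itv //.
Qed.

Lemma left_endpoints_coset (k : int) (x : R) : E k x ->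
  forall y, E k y <-> exists z : int, y = x + z%:~R * n%:R ^ k.
Proof. exact: tiling_coset (scale_gt0 k) (left_endpoints_tiling k). Qed.

(** The short tile containing [x] starts at or before [x]; nesting puts it
inside the long tile that starts at [x]. *)
Lemma left_endpoints_sub (k : int) : E (k + 1) `<=` E k.
Proof.
move=> x Ex.
have [y Ey /andP[y1 y2]] := (left_endpoints_tiling k).1 x.
have l0 := scale_gt0 k.
have lt_scale : n%:R ^ k < n%:R ^ (k + 1) :> R.
  by rewrite scaleS ltr_pMl// ltr1n.
suff -> : x = y by [].
have [yx|xy] := ltP y x; last by apply/eqP; rewrite eq_le xy y1.
have in_tile (z u l : R) : z <= u < z + l -> `[z, z + l[%classic u.
  by rewrite /= in_itv.
have [sub|sub|sub] := grid_nested hG Ey Ex.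
- have : `[y, y + n%:R ^ k[%classic y by apply: in_tile; lra.
  by rewrite -sub /= !in_itv /=; lra.
(* The end of the short interval lies in the long one. *)
- have : `[x, x + n%:R ^ (k + 1)[%classic (y + n%:R ^ k) by apply: in_tile; lra.
  by rewrite -sub /= !in_itv /=; lra.
- have : set0 x; last by [].
  by rewrite -sub; split; apply: in_tile; lra.
Qed.

Lemma left_endpoints_small (m : nat) : E 0 `<=` E (- m%:Z).
Proof.
elim: m => [//|m IH] x /IH Ex; apply: left_endpoints_sub.
by have -> : - m.+1%:Z + 1 = - m%:Z by rewrite -addn1 PoszD opprD subrK.
Qed.

(** The digit is the residue modulo [n] of the position, in units of [n ^ j]
from [x], of any left endpoint at the scale [j + 1]. *)
Lemma next_digit (j : nat) (x : R) : E j%:Z x ->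
  exists a : 'I_n, E j.+1%:Z (x + (a * n ^ j)%:R).
Proof.
move=> Ex.
have eS : j.+1%:Z = j%:Z + 1 by rewrite -addn1 PoszD.
have [y Ey _] := (left_endpoints_tiling j.+1%:Z).1 0.
have [z ey] : exists z : int, y = x + z%:~R * n%:R ^ j%:Z.
  by apply/(left_endpoints_coset Ex); apply: left_endpoints_sub; rewrite -eS.
have n0 : n%:Z != 0 by rewrite eqz_nat -lt0n ltnW.
have r0 : 0 <= (z %% n%:Z)%Z := modz_ge0 z n0.
have rn : (`|(z %% n%:Z)%Z| < n)%N.
  by rewrite -ltz_nat gez0_abs// ltz_pmod// ltz_nat ltnW.
exists (Ordinal rn); apply/(left_endpoints_coset Ey).
exists (- (z %/ n%:Z)%Z).
have ez : z%:~R = (z %/ n%:Z)%Z%:~R * n%:R + `|(z %% n%:Z)%Z|%N%:R :> R.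
  rewrite {1}(divz_eq z n%:Z) intrD intrM; congr (_ + _).
  by rewrite -{1}(gez0_abs r0).
rewrite ey eS scaleS ez -exprnP natrM natrX rmorphN /=; lra.
Qed.

(** The digits are chosen one at a time, each depending on the offset reached
before it. *)
Lemma exists_location (delta : R) : E 0 delta ->
  exists a : nat -> 'I_n, forall j : nat, E j%:Z (delta + (location a j)%:R).
Proof.
move=> E0.
have /boolp.choice[f hf] : forall p : nat * nat, exists a : 'I_n,
    E p.1%:Z (delta + p.2%:R) ->
    E p.1.+1%:Z (delta + (p.2 + a * n ^ p.1)%:R).
  move=> [j L] /=.
  have [Ej|nEj] := pselect (E j%:Z (delta + L%:R)).
    by have [a Ea] := next_digit Ej; exists a => _; rewrite natrD addrA.
  by exists (Ordinal (ltnW hn)) => /nEj.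
pose fix L (j : nat) : nat :=
  if j is i.+1 then (L i + f (i, L i) * n ^ i)%N else 0%N.
exists (fun j => f (j, L j)) => j.
have -> : location (fun j => f (j, L j)) j = L j.
  by elim: j => [|j IH]; rewrite /location ?big_ord0// big_ord_recr /= -IH.
elim: j => [|j IH]; first by rewrite addr0.
exact: (hf (j, L j)).
Qed.

End Grid.

(** The points [delta], for [0 <= m], and [delta + L (- m)], for [m < 0], are
the anchors of the generation [m]; each is a left endpoint of [G] at the scale
[n ^ (- m)], so both sides are the tiles of one and the same coset. *)
Lemma grid_generationE (R : realType) (n : nat) (G : set (set R)) (delta : R)
    (L : nat -> nat) (hn : (2 <= n)%N) (hG : n_grid n G) :
  left_endpoints n G 0 delta ->
  (forall j : nat, left_endpoints n G j%:Z (delta + (L j)%:R)) ->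
  forall m : int, grid_generation n delta L m =
    [set Q | G Q /\ lcro_interval (n%:R ^ (- m)) Q].
Proof.
move=> E0 EL m.
pose x : R := if 0 <= m then delta else delta + (L `|m|%N)%:R.
have Ex : left_endpoints n G (- m) x.
  rewrite /x; case: (lerP 0 m) => [m0|m0].
    by have := left_endpoints_small hn hG `|m|%N E0; rewrite gez0_abs.
  by have := EL `|m|%N; rewrite ltz0_abs.
have -> : grid_generation n delta L m =
    [set `[x + k%:~R / n%:R ^ m, x + (k + 1)%:~R / n%:R ^ m[%classic
      | k in [set: int]].
  by rewrite /grid_generation /x; case: ifP.
have tileE (k : int) :
    `[x + k%:~R / n%:R ^ m, x + (k + 1)%:~R / n%:R ^ m[%classic =
    `[x + k%:~R * n%:R ^ (- m), x + k%:~R * n%:R ^ (- m) + n%:R ^ (- m)[%classic.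
  by rewrite invr_expz intrD mulrDl mul1r addrA.
apply/seteqP; split=> [_ [k _ <-]|Q [GQ /lcro_intervalE [y eQ]]] /=.
  rewrite tileE; split; last by apply/lcro_intervalE; eexists.
  have /= := proj2 (left_endpoints_coset hn hG Ex (x + k%:~R * n%:R ^ (- m))).
  by apply; exists k.
have Ey : left_endpoints n G (- m) y by rewrite /left_endpoints /= -eQ.
have [k ey] := proj1 (left_endpoints_coset hn hG Ex y) Ey.
by exists k => //; rewrite tileE eQ ey.
Qed.

Theorem proposition3p10 (R : realType) (n : nat) (hn : (2 <= n)%N)
    (G : set (set R)) (hG : n_grid n G) :
  exists (delta : R) (a : nat -> 'I_n), G = grid n delta (location a).
Proof.
have [delta E0 _] := (left_endpoints_tiling hn hG 0).1 0.
have [a Ea] := exists_location hn hG E0.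
exists delta, a; apply/seteqP; split=> [Q GQ|Q [m _]].
  have [k lQ] := grid_length hG GQ.
  by exists (- k) => //; rewrite (grid_generationE hn hG E0 Ea) opprK.
by rewrite (grid_generationE hn hG E0 Ea) => -[].
Qed.
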